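(* Let $\mathcal{A} \subseteq M_n$ be an operator algebra. The following are equivalent: (i) there is an ordered orthonormal basis of $\mathbb{C}^n$ relative to which the matrix of every element of $\mathcal{A}$ is upper triangular and constant on the main diagonal; (ii) every operator algebra similar to $\mathcal{A}$ (i.e., every $S\mathcal{A}S^{-1}$ for $S \in M_n$ invertible) is antisymmetric; (iii) $\mathcal{A}$ is antisymmetric with respect to any inner product on $\mathbb{C}^n$; (iv) $\mathcal{A}$ contains no projections besides $0$ and (possibly) $I$; (v) every operator in $\mathcal{A}$ has exactly one eigenvalue.
   Context: $M_n=M_n(\mathbb{C})$ is identified with the linear operators on $\mathbb{C}^n$, with the standard inner product unless otherwise said. An operator algebra in $M_n$ is a complex linear subspace closed under products (not necessarily unital or self-adjoint). An operator algebra $\mathcal{A}$ is antisymmetric if $\mathcal{A}\cap\mathcal{A}^*$ is $\{0\}$ or $\mathbb{C}\cdot I$; antisymmetric with respect to a given inner product means that this holds with the adjoint operation taken relative to that inner product. A projection is a possibly nonorthogonal projection, i.e., an operator $P$ with $P=P^2$. *)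

(* Defs.v *)
From HB Require Import structures.
From mathcomp Require Import all_boot all_order all_algebra.
From mathcomp Require Import sesquilinear.
From mathcomp Require Import classical_sets reals complex.

Set Implicit Arguments.
Unset Strict Implicit.
Unset Printing Implicit Defensive.

Import Order.TTheory GRing.Theory Num.Theory Num.Def.
Local Open Scope ring_scope.
Local Open Scope classical_set_scope.

(* C^n is 'cV[C]_n, and the matrix X is identified with the operator         *)
(* v |-> X *m v.                                                             *)

Section StandardInnerProduct.
Variables (C : numClosedFieldType) (n : nat).

Definition cdot (u v : 'cV[C]_n) : C := \sum_i u i 0 * (v i 0)^*.

Fact cdot_bilinear : bilinear_for *%R (conjC \; *%R) cdot.
Proof.
split=> [w a u v | u a v w]; rewrite /cdot /= mulr_sumr -big_split /=;
  apply: eq_bigr => i _; rewrite !mxE.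
  by rewrite mulrDl mulrA.
by rewrite rmorphD rmorphM mulrDr mulrCA.
Qed.

HB.instance Definition _ :=
  bilinear_isBilinear.Build C 'cV[C]_n 'cV[C]_n C *%R (conjC \; *%R)
    cdot cdot_bilinear.

Fact cdot_hermitian (u v : 'cV[C]_n) : cdot u v = (-1) ^+ false * (cdot v u)^*.
Proof.
rewrite expr0 mul1r /cdot rmorph_sum; apply: eq_bigr => i _.
by rewrite rmorphM /= conjCK mulrC.
Qed.

HB.instance Definition _ :=
  isHermitianSesquilinear.Build C 'cV[C]_n false conjC cdot cdot_hermitian.

Fact cdot_gt0 (u : 'cV[C]_n) : u != 0 -> 0 < cdot u u.
Proof.
move=> /cV0Pn[i ui]; rewrite /cdot (bigD1 i) //= ltr_wpDr ?mul_conjC_gt0 //.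
by apply: sumr_ge0 => j _; rewrite mul_conjC_ge0.
Qed.

HB.instance Definition _ := isDotProduct.Build C 'cV[C]_n cdot cdot_gt0.

End StandardInnerProduct.

Section OperatorAlgebras.
Variables (C : numClosedFieldType) (n : nat).
Implicit Types (A : {vspace 'M[C]_n}) (X Y S : 'M[C]_n).
Implicit Types (ip : {dot 'cV[C]_n for conjC}) (e : n.-tuple 'cV[C]_n).

Definition operator_algebra A : Prop :=
  forall X Y, X \in A -> Y \in A -> X *m Y \in A.

Definition is_adjoint ip X Y : Prop :=
  forall u v, ip (X *m u) v = ip u (Y *m v).

Definition adjoint_set ip A : set 'M[C]_n :=
  [set Y | exists2 X, X \in A & is_adjoint ip X Y].

Definition antisymmetric_wrt ip A : Prop :=
  [set` A] `&` adjoint_set ip A = [set 0] \/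
  [set` A] `&` adjoint_set ip A = [set a%:M | a in [set: C]].

Definition antisymmetric_alg A : Prop := antisymmetric_wrt (@cdot C n) A.

Definition conj_algebra S A : {vspace 'M[C]_n} :=
  (linfun (mulmxr (invmx S) \o mulmx S) @: A)%VS.

(* Column j holds the coordinates of the image of the j-th basis vector. *)
Definition matrix_in_basis e X : 'M[C]_n :=
  \matrix_(i, j) coord e i (X *m tnth e j).

Definition orthonormal_basis e : Prop :=
  basis_of fullv e /\ orthonormal (@cdot C n) e.

Definition upper_triangular X : Prop :=
  forall i j : 'I_n, (j < i)%N -> X i j = 0.

Definition constant_diagonal X : Prop :=
  forall i j : 'I_n, X i i = X j j.

(* [eigenvalue X a] of mxalgebra concerns row vectors; [leigenvalue] is      *)
(* applied here to the operator on columns.                                  *)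
Definition is_eigenvalue X (a : C) : Prop :=
  passmx.leigenvalue (linfun (mulmx X) : 'End('cV[C]_n)) a.

End OperatorAlgebras.

(* Main.v *)
(* An idempotent is self-adjoint for a suitable inner product, and orthogonal
   after a suitable similarity, so (ii) and (iii) each forbid nontrivial ones.
   If X has two eigenvalues, a Bezout identity for the factors of its
   characteristic polynomial yields a nontrivial idempotent polynomial in X
   without constant term.  When all elements have a single eigenvalue, the
   traceless ones form a nil algebra N.  For an N-stable proper subspace V, a
   vector v outside V with dim (N v + V) minimal satisfies N v <= V: otherwise
   some w in N v outside V lies in N w + V, against nilpotency.  Iterating and
   orthonormalising gives (i).  Finally each element of a triangular algebra
   with constant diagonals is a scalar plus a nilpotent, a property stable under
   similarity; and a self-adjoint operator of that form is scalar, which applies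
   to the real and imaginary parts of the elements of A whose adjoints lie in
   A. *)

Require Import Defs.
From HB Require Import structures.
From mathcomp Require Import all_boot all_order all_algebra.
From mathcomp Require Import sesquilinear.
From mathcomp Require Import classical_sets reals complex.
From mathcomp Require Import ring.

Set Implicit Arguments.
Unset Strict Implicit.
Unset Printing Implicit Defensive.

Import Order.TTheory GRing.Theory Num.Theory Num.Def.
Local Open Scope ring_scope.

(** * Eigenvalues, and idempotents that are polynomials in an operator *)

Section Spectrum.
Variables (C : numClosedFieldType) (n : nat).
Implicit Types (X P : 'M[C]_n.+1) (A : {vspace 'M[C]_n.+1}).

Lemma char_poly_tr X : char_poly X^T = char_poly X.
Proof.
rewrite /char_poly -det_tr; congr (\det _).
by apply/matrixP=> i j; rewrite !mxE eq_sym.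
Qed.

Lemma is_eigenvalueP X a :
  is_eigenvalue X a <-> exists2 v : 'cV_n.+1, v != 0 & X *m v = a *: v.
Proof.
have kerE (v : 'cV_n.+1) : (v \in passmx.leigenspace (linfun (mulmx X)) a)
                = (X *m v == a *: v).
  by rewrite memv_ker !lfunE /= !lfunE /= !lfunE /= subr_eq0 id_lfunE.
rewrite /is_eigenvalue /passmx.leigenvalue; split=> [|[v v0 /eqP]].
  set E := (E in E != _) => E0; exists (vpick E : 'cV_n.+1).
    by rewrite (vpick0 E).
  by apply/eqP; rewrite -kerE memv_pick.
by rewrite -kerE => va; apply: contraNneq v0 => E0; rewrite E0 memv0 in va.
Qed.

Lemma is_eigenvalueE X a : is_eigenvalue X a <-> root (char_poly X) a.
Proof.
rewrite -char_poly_tr -eigenvalue_root_char; split=> [/is_eigenvalueP[v v0 Xv]|].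
  apply/eigenvalueP; exists v^T; last by rewrite -(inj_eq trmx_inj) trmxK trmx0.
  by rewrite -trmx_mul Xv linearZ.
case/eigenvalueP=> v vX v0; apply/is_eigenvalueP; exists v^T.
  by rewrite -(inj_eq trmx_inj) trmxK trmx0.
by rewrite -[X]trmxK -trmx_mul vX linearZ.
Qed.

(** The factor ['X] removes the constant term: [A] may lack the identity, so only such polynomials
    in [X] are sure to stay in [A]. *)
Lemma horner_mx_algebra A X r :
  operator_algebra A -> X \in A -> horner_mx X ('X * r) \in A.
Proof.
move=> algA XA; elim/poly_ind: r => [|r c IHr].
  by rewrite mulr0 raddf0 mem0v.
rewrite mulrDr mulrA rmorphD /= ['X * c%:P]mulrC mul_polyC linearZ /= horner_mx_X.
rewrite memvD ?memvZ // rmorphM /= horner_mx_X.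
exact: algA.
Qed.

(** Write [char_poly X = q * ('X - a%:P) ^+ m] with [q] nonzero at [a]. Since [a != 0],
    [('X - a%:P) ^+ m] is coprime even to ['X * q], so a Bezout identity gives a multiple [p] of
    ['X * q] that is 1 modulo that power. Thus [p] is idempotent modulo [char_poly X], with value 1
    at [a] and 0 at [b]. *)
Lemma algebra_separating_projection A X a b :
    operator_algebra A -> X \in A -> root (char_poly X) a ->
    root (char_poly X) b -> a != b -> a != 0 ->
  exists P, [/\ P \in A, P *m P = P, P != 0 & P != 1%:M].
Proof.
move=> algA XA Xa Xb neq_ab a0.
have [m [q /implyP/= qa Xq]] := multiplicity_XsubC (char_poly X) a.
have {}qa : ~~ root q a by apply: qa; rewrite monic_neq0 ?char_poly_monic.
have qb : root q b.
  move: Xb; rewrite Xq rootM => /orP[//|]; rewrite /root horner_exp expf_eq0.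
  by rewrite hornerXsubC subr_eq0 => /andP[_ /eqP ba]; rewrite ba eqxx in neq_ab.
have : coprimep (('X - a%:P) ^+ m) ('X * q).
  rewrite coprimep_sym coprimep_expr // coprimep_XsubC rootM (negPf qa) orbF.
  by rewrite rootX.
case/Bezout_eq1_coprimepP=> -[u v] /= uv1.
pose p := 'X * (q * v).
have idemp : horner_mx X p *m horner_mx X p = horner_mx X p.
  apply/eqP; rewrite -subr_eq0 mulmxE -rmorphM -rmorphB /=.
  have -> : p * p - p = char_poly X * (- ('X * v * u)).
    by rewrite -[X in _ - X]mulr1 -uv1 Xq /p; ring.
  by rewrite rmorphM /= Cayley_Hamilton mul0r.
(* An eigenvector for [c] is an eigenvector of [horner_mx X r] for [r.[c]], so values of [p] at [a]
   and [b] rule out 0 and 1. *)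
have ev r c : root (char_poly X) c ->
    exists2 w : 'cV_n.+1, w != 0 & horner_mx X r *m w = r.[c] *: w.
  case/is_eigenvalueE/is_eigenvalueP=> w w0 Xw; exists w => //.
  elim/poly_ind: r => [|r d IHr]; first by rewrite raddf0 mul0mx horner0 scale0r.
  rewrite rmorphD rmorphM /= horner_mx_X horner_mx_C mulmxDl -mulmxE -mulmxA Xw.
  by rewrite -scalemxAr IHr mul_scalar_mx hornerMXaddC scalerA mulrC scalerDl.
exists (horner_mx X p); split=> //; first exact: horner_mx_algebra.
  apply/eqP=> p0; have [w w0] := ev p _ Xa; rewrite p0 mul0mx => /esym/eqP.
  rewrite scaler_eq0 (negPf w0) orbF => /eqP pa0.
  have := congr1 (horner^~ a) uv1.
  have -> : v * ('X * q) = p by rewrite /p; ring.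
  rewrite hornerD hornerM horner_exp hornerXsubC subrr expr0n pa0 addr0 hornerC.
  (* For [m = 0] the power of 0 is 1 and gives no contradiction; but then [char_poly X] is [q],
     which has no root at [a]. *)
  case: m Xq {uv1 p idemp p0 pa0} => [|m] Xq; last first.
    by rewrite mulr0 => /esym/eqP; rewrite oner_eq0.
  by rewrite Xq mulr1 (negPf qa) in Xa.
apply/eqP=> p1; have [w w0] := ev p _ Xb; rewrite p1 mul1mx.
rewrite /p !hornerM (rootP qb) mul0r mulr0 scale0r => w0'.
by rewrite w0' eqxx in w0.
Qed.

End Spectrum.

(** * Algebras of operators with one eigenvalue: scalar plus nilpotent *)

Section Nilpotency.
Variables (C : numClosedFieldType) (n : nat).
Implicit Types (X Y : 'M[C]_n.+1) (A N : {vspace 'M[C]_n.+1}).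

Lemma unique_eigenvalue_char_poly X :
  (exists! a, is_eigenvalue X a) ->
  exists a, char_poly X = ('X - a%:P) ^+ n.+1.
Proof.
case=> a [_ a_uniq]; exists a.
have [r Xr] := closed_field_poly_normal (char_poly X).
rewrite (monicP (char_poly_monic X)) scale1r in Xr.
have ra : all (pred1 a) r.
  apply/allP=> b rb /=; rewrite eq_sym; apply/eqP/a_uniq/is_eigenvalueE.
  by rewrite Xr root_prod_XsubC.
have sr : size r = n.+1.
  by apply/eqP; rewrite -eqSS -(size_prod_XsubC r id) -Xr size_char_poly.
by rewrite Xr (all_pred1P _ _ ra) sr big_nseq iter_mulr_1.
Qed.

Lemma char_poly_power_nilpotent X a :
  char_poly X = ('X - a%:P) ^+ n.+1 -> (X - a%:M) ^+ n.+1 = 0.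
Proof.
move=> Xa; have := Cayley_Hamilton X.
by rewrite Xa rmorphXn rmorphB /= horner_mx_X horner_mx_C.
Qed.

Lemma char_poly_power_trace X a :
  char_poly X = ('X - a%:P) ^+ n.+1 -> \tr X = a *+ n.+1.
Proof.
(* The trace is minus a coefficient of the characteristic polynomial, and [a%:M] has the same
   characteristic polynomial as [X]. *)
move=> Xa; apply/oppr_inj; rewrite -mxtrace_scalar -!char_poly_trace //.
congr (_`_ _); rewrite Xa char_poly_trig ?scalar_mx_is_trig //.
rewrite (eq_bigr (fun=> 'X - a%:P)) ?prodr_const ?card_ord // => i _.
by rewrite mxE eqxx.
Qed.

(* Traces pick out the nilpotents linearly: an element with the single
   eigenvalue a has trace (n + 1) a. *)
Definition traceless A := (A :&: lker (linfun (@mxtrace C n.+1 : 'M_n.+1 -> C^o)))%VS.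

Lemma mem_traceless A X : (X \in traceless A) = (X \in A) && (\tr X == 0).
Proof. by rewrite memv_cap memv_ker lfunE. Qed.

Section OneEigenvalue.
Variable A : {vspace 'M[C]_n.+1}.
Hypothesis algA : operator_algebra A.
Hypothesis oneA : forall X, X \in A -> exists! a, is_eigenvalue X a.

(** The trace is [n.+1] times the only eigenvalue, which therefore vanishes in characteristic
    zero. *)
Lemma traceless_char_poly X : X \in traceless A -> char_poly X = 'X ^+ n.+1.
Proof.
rewrite mem_traceless => /andP[XA /eqP X0].
have [a Xa] := unique_eigenvalue_char_poly (oneA XA).
have /eqP := char_poly_power_trace Xa; rewrite X0 eq_sym mulrn_eq0 /= => /eqP a0.
by rewrite Xa a0 subr0.
Qed.

Lemma traceless_nilpotent X : X \in traceless A -> X ^+ n.+1 = 0.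
Proof.
move=> /traceless_char_poly X0; have := @char_poly_power_nilpotent X 0.
by rewrite polyC0 (raddf0 (@scalar_mx C n.+1)) !subr0; apply.
Qed.

(** The product has a single eigenvalue because it lies in [A], and determinant 0 because [X] is
    singular; so that eigenvalue, and with it the trace, is 0. *)
Lemma traceless_algebra : operator_algebra (traceless A).
Proof.
move=> X Y X0 Y0; have [XA YA] : X \in A /\ Y \in A.
  by move: X0 Y0; rewrite !mem_traceless => /andP[-> _] /andP[-> _].
have XYA := algA XA YA; have [a XYa] := unique_eigenvalue_char_poly (oneA XYA).
rewrite mem_traceless XYA (char_poly_power_trace XYa).
suff -> : a = 0 by rewrite mul0rn eqxx.
have detX : \det X = 0.
  apply/eqP; have /esym/eqP := char_poly_det X.
  by rewrite traceless_char_poly // coefXn mulf_eq0 signr_eq0.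
have := char_poly_det (X *m Y).
rewrite det_mulmx detX mul0r mulr0 XYa -horner_coef0 horner_exp hornerXsubC sub0r.
by move/eqP; rewrite expf_eq0 oppr_eq0 => /andP[_ /eqP].
Qed.

(** Subtracting the eigenvalue [a] kills the trace; the point is that [a%:M] itself lies in [A]. *)
Lemma sub_scalar_traceless X :
  X \in A -> exists a : C, X - a%:M \in traceless A.
Proof.
move=> XA; have [a Xa] := unique_eigenvalue_char_poly (oneA XA); exists a.
rewrite mem_traceless raddfB /= mxtrace_scalar (char_poly_power_trace Xa) subrr.
rewrite eqxx andbT memvB //; have [->|a0] := eqVneq a 0; first by rewrite (raddf0 (@scalar_mx C n.+1)) mem0v.
(* Cayley-Hamilton expresses a nonzero multiple of I as a polynomial in X
   without constant term. *)
pose p := ('X - a%:P) ^+ n.+1 - ((- a) ^+ n.+1)%:P.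
have /factor_theorem[r pr] : root p 0.
  by rewrite /root hornerD hornerN hornerC horner_exp hornerXsubC sub0r subrr.
have := Cayley_Hamilton X; rewrite Xa -[_ ^+ n.+1](subrK ((- a) ^+ n.+1)%:P).
rewrite -/p pr subr0 mulrC rmorphD /= horner_mx_C => /eqP; rewrite addr_eq0 => /eqP.
move/(congr1 -%R); rewrite opprK => aI.
rewrite -[a](mulfVK (expf_neq0 n.+1 (_ : - a != 0))) ?oppr_eq0 //.
rewrite -scale_scalar_mx memvZ // -aI memvN.
exact: horner_mx_algebra.
Qed.

Lemma scalar_add_nilpotent X :
  X \in A -> exists a : C, (X - a%:M) ^+ n.+1 = 0.
Proof. by case/sub_scalar_traceless=> a /traceless_nilpotent; exists a. Qed.

End OneEigenvalue.
End Nilpotency.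

(** * Self-adjoint operators and antisymmetry for an arbitrary inner product *)

Section Adjoints.
Variables (C : numClosedFieldType) (n : nat).
Variable ip : {dot 'cV[C]_n.+1 for conjC}.
Implicit Types (X Y Z H P : 'M[C]_n.+1) (A : {vspace 'M[C]_n.+1}).

Lemma dotC u v : ip u v = (ip v u)^*.
Proof. by rewrite hermC expr0 mul1r. Qed.

Lemma is_adjoint_sym X Y : is_adjoint ip X Y -> is_adjoint ip Y X.
Proof. by move=> XY u v; rewrite dotC -XY -dotC. Qed.

Lemma is_adjointD X Y X' Y' :
  is_adjoint ip X X' -> is_adjoint ip Y Y' -> is_adjoint ip (X + Y) (X' + Y').
Proof.
move=> XX' YY' u v; rewrite !mulmxDl linearDl linearDr.
by congr (_ + _); [apply: XX' | apply: YY'].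
Qed.

Lemma is_adjointZ a X X' :
  is_adjoint ip X X' -> is_adjoint ip (a *: X) (a^* *: X').
Proof.
move=> XX' u v; rewrite -!scalemxAl linearZl_LR linearZr_LR /= conjCK.
by congr (_ * _); apply: XX'.
Qed.

Lemma is_adjoint_scalar a : is_adjoint ip a%:M a^*%:M.
Proof. by move=> u v; rewrite !mul_scalar_mx linearZl_LR linearZr_LR /= conjCK. Qed.

(** Moving one factor across the product turns the squared norm of [Z ^+ k.+1 *m w] into the product
    of [Z ^+ k *m w] with [Z ^+ k.+2 *m w], so a vanishing exponent can be lowered down to 1. *)
Lemma selfadjoint_nilpotent_eq0 Z k : is_adjoint ip Z Z -> Z ^+ k = 0 -> Z = 0.
Proof.
move=> adjZ; case: k => [|k]; first by move/eqP; rewrite expr0 oner_eq0.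
elim: k => [|k IHk] Zk0; first by rewrite expr1 in Zk0.
have Zk (w : 'cV_n.+1) : Z ^+ k.+1 *m w = 0.
  apply/eqP; rewrite -(dnorm_eq0 ip) {1}exprS -mulmxA.
  have -> : ip (Z *m (Z ^+ k *m w)) (Z ^+ k.+1 *m w)
              = ip (Z ^+ k *m w) (Z *m (Z ^+ k.+1 *m w)) by apply: adjZ.
  by rewrite [Z *m _]mulmxA mulmxE -exprS Zk0 mul0mx linear0r.
by apply: IHk; apply/matrixP=> i j; have /colP/(_ i) := Zk (delta_mx j 0);
  rewrite -colE !mxE.
Qed.

(** The vector [w] is the last nonzero one among the iterates of [u]. *)
Lemma nilpotent_kernel Z k (u : 'cV_n.+1) :
  u != 0 -> Z ^+ k *m u = 0 -> exists2 w : 'cV_n.+1, w != 0 & Z *m w = 0.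
Proof.
elim: k u => [|k IHk] u u0; first by rewrite expr0 mul1mx => /eqP; rewrite (negPf u0).
rewrite exprSr -mulmxA; have [Zu0 _|Zu0] := eqVneq (Z *m u) 0; first by exists u.
exact: IHk.
Qed.

(** The nilpotent part has a kernel vector, so [a] is an eigenvalue of [H] and hence real; then
    [H - a%:M] is self-adjoint as well as nilpotent. *)
Lemma selfadjoint_scalar_add_nilpotent H a k :
  is_adjoint ip H H -> (H - a%:M) ^+ k = 0 -> H = a%:M.
Proof.
move=> adjH Hk; apply/eqP; rewrite -subr_eq0; apply/eqP.
apply: selfadjoint_nilpotent_eq0 (Hk).
have one_neq0 : (const_mx 1 : 'cV[C]_n.+1) != 0.
  by apply/eqP=> /colP/(_ 0)/eqP; rewrite !mxE oner_eq0.
have [|w w0] := nilpotent_kernel one_neq0 (_ : (H - a%:M) ^+ k *m _ = 0).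
  by rewrite Hk mul0mx.
move=> /eqP; rewrite mulmxBl subr_eq0 mul_scalar_mx => /eqP Hw.
have a_real : a^* = a.
  have := adjH w w; rewrite Hw linearZl_LR linearZr_LR /= => /eqP.
  by rewrite -subr_eq0 -mulrBl mulf_eq0 dnorm_eq0 (negPf w0) orbF subr_eq0 => /eqP.
rewrite -[- _]scaleN1r; apply: is_adjointD => //.
have := is_adjointZ (-1) (is_adjoint_scalar a).
by rewrite rmorphN rmorph1 a_real.
Qed.

Lemma scalar_add_nilpotent_antisymmetric A k :
  (forall X, X \in A -> exists a : C, (X - a%:M) ^+ k = 0) ->
  antisymmetric_wrt ip A.
Proof.
move=> nilA.
have scal Y : ([set` A] `&` adjoint_set ip A)%classic Y -> exists b, Y = b%:M.
  move=> [/= YA [X XA adjX]].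
  (* Up to real factors these are the real and imaginary parts of [Y], and [Y] is half of
     [H - 'i *: K]. *)
  pose H := Y + X; pose K := 'i *: (Y + (- 1) *: X).
  have adjY := is_adjoint_sym adjX.
  have adjH : is_adjoint ip H H by rewrite {2}/H addrC; apply: is_adjointD.
  have adjK : is_adjoint ip K K.
    suff -> : is_adjoint ip K K = is_adjoint ip K ('i^* *: (X + (-1)^* *: Y)).
      exact/is_adjointZ/is_adjointD/is_adjointZ.
    by rewrite /K conjCi rmorphN rmorph1 !scaleN1r scaleNr -scalerN opprD opprK addrC.
  have [h Hh] : exists h : C, (H - h%:M) ^+ k = 0 by apply: nilA; rewrite memvD.
  have [c Kc] : exists h : C, (K - h%:M) ^+ k = 0.
    by apply: nilA; rewrite memvZ // memvD // memvZ.
  have HE := selfadjoint_scalar_add_nilpotent adjH Hh.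
  have KE := selfadjoint_scalar_add_nilpotent adjK Kc.
  exists (2^-1 * (h - 'i * c)).
  rewrite -scale_scalar_mx raddfB /= -scale_scalar_mx -HE -KE /H /K scalerA.
  rewrite -expr2 sqrCi !scaleN1r opprK addrACA subrr addr0 -mulr2n -scaler_nat.
  by rewrite scalerA mulVf ?scale1r // pnatr_eq0.
(* The intersection consists of scalars; whether it is all of them or only 0 depends on the identity
   being in [A]. *)
have [A1|A1] := boolP (1%:M \in A).
  have Aa a : a%:M \in A by rewrite -[a]mulr1 -scale_scalar_mx memvZ.
  right; apply/seteqP; split=> [Y /scal[b ->]|_ [a _ <-]]; first by exists b.
  split=> //=; exists a^*%:M => //.
  by have := is_adjoint_scalar a^*; rewrite conjCK.
left; apply/seteqP; split=> [Y DY|_ ->] /=; last first.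
  split; rewrite /= ?mem0v //; exists 0; rewrite ?mem0v // => u v.
  by rewrite !mul0mx linear0l linear0r.
have [b Yb] := scal Y DY; case: DY => /= YA _; rewrite Yb in YA *.
have [->|b0] := eqVneq b 0; first by rewrite (raddf0 (@scalar_mx C n.+1)).
by case/negP: A1; rewrite -(mulVf b0) -scale_scalar_mx memvZ.
Qed.

(** Such a [P] belongs to the intersection of [A] with its adjoint, hence is scalar, and an
    idempotent scalar is 0 or 1. *)
Lemma antisymmetric_selfadjoint_projection A P :
    antisymmetric_wrt ip A -> P \in A -> P *m P = P -> is_adjoint ip P P ->
  P = 0 \/ P = 1%:M.
Proof.
move=> asymA PA PP adjP.
have : ([set` A] `&` adjoint_set ip A)%classic P by split=> //; exists P.
case: asymA => -> /=; first by left.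
case=> a _ aP; move: PP; rewrite -aP -scalar_mxM => /matrixP/(_ 0 0)/eqP.
rewrite !mxE eqxx !mulr1n -subr_eq0 -[X in _ - X]mulr1 -mulrBr mulf_eq0 subr_eq0.
case/orP=> /eqP ->; [left | by right].
exact: (raddf0 (@scalar_mx C n.+1)).
Qed.

End Adjoints.

(** * An inner product making an idempotent self-adjoint *)

Section ProjectionDot.
Variables (C : numClosedFieldType) (n : nat) (P : 'M[C]_n).

(* Makes the range and the kernel of an idempotent P orthogonal. *)
Definition proj_dot (u v : 'cV[C]_n) : C :=
  cdot (P *m u) (P *m v) + cdot (u - P *m u) (v - P *m v).

Fact proj_dot_bilinear : bilinear_for *%R (conjC \; *%R) proj_dot.
Proof.
have [cdotPl cdotPr] := @cdot_bilinear C n.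
have mulDDr (a x y z t : C) : a * x + y + (a * z + t) = a * (x + z) + (y + t).
  by rewrite mulrDr addrACA.
split=> [w a u v|u a v w]; rewrite /proj_dot mulmxDr -scalemxAr opprD addrACA.
  by rewrite -scalerBr !cdotPl; apply: mulDDr.
by rewrite -scalerBr !cdotPr; apply: mulDDr.
Qed.

HB.instance Definition _ :=
  bilinear_isBilinear.Build C 'cV[C]_n 'cV[C]_n C *%R (conjC \; *%R)
    proj_dot proj_dot_bilinear.

Fact proj_dot_hermitian u v :
  proj_dot u v = (-1) ^+ false * (proj_dot v u)^*.
Proof.
rewrite expr0 mul1r /proj_dot rmorphD /=.
by congr (_ + _); rewrite cdot_hermitian expr0 mul1r.
Qed.

HB.instance Definition _ :=
  isHermitianSesquilinear.Build C 'cV[C]_n false conjC proj_dot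
    proj_dot_hermitian.

Fact proj_dot_gt0 u : u != 0 -> 0 < proj_dot u u.
Proof.
move=> u0; rewrite /proj_dot; have [Pu0|Pu0] := eqVneq (P *m u) 0.
  by rewrite Pu0 subr0 linear0l add0r dnorm_gt0.
by rewrite ltr_wpDr ?dnorm_ge0 // dnorm_gt0.
Qed.

HB.instance Definition _ := isDotProduct.Build C 'cV[C]_n proj_dot proj_dot_gt0.

(** Both sides reduce to [cdot (P *m u) (P *m v)], since [P *m u - P *m (P *m u)] is 0. *)
Lemma proj_dot_adjoint : P *m P = P -> is_adjoint proj_dot P P.
Proof.
move=> PP u v; rewrite -[LHS]/(proj_dot _ _) -[RHS]/(proj_dot _ _) /proj_dot.
rewrite !mulmxA PP !subrr.
by rewrite linear0l linear0r.
Qed.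

End ProjectionDot.

(** * Similarity and diagonalization of idempotents *)

Lemma diag_mx_adjoint (C : numClosedFieldType) n (d : 'rV[C]_n) :
  is_adjoint (@cdot C n) (diag_mx d) (diag_mx (map_mx conjC d)).
Proof.
move=> u v; apply: eq_bigr => i _.
by rewrite !mul_diag_mx !mxE rmorphM /= conjCK mulrCA mulrA.
Qed.

Lemma mem_conj_algebra (C : numClosedFieldType) n (A : {vspace 'M[C]_n}) S X :
  X \in A -> S *m X *m invmx S \in conj_algebra S A.
Proof.
move=> XA; rewrite /conj_algebra.
by have := memv_img (linfun (mulmxr (invmx S) \o mulmx S)) XA; rewrite lfunE.
Qed.

(** The minimal polynomial divides ['X * ('X - 1)], which has distinct roots. *)
Lemma projection_diagonalizable (C : numClosedFieldType) n (P : 'M[C]_n.+1) :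
  P *m P = P -> exists2 S, S \in unitmx &
    exists d : 'rV[C]_n.+1, S *m P *m invmx S = diag_mx d.
Proof.
move=> PP; have [S Su] : diagonalizable P.
  apply/diagonalizableP; exists [:: 0; 1]; first by rewrite /= inE eq_sym oner_eq0.
  rewrite !big_cons big_nil mulr1 subr0 dvd_mxminpoly rmorphM rmorphB /=.
  by rewrite horner_mx_X horner_mx_C mulrBr mulr1 -mulmxE PP subrr.

case/diagonalizable_forPex=> d /(simmxRL Su) dP; exists S => //.
by exists d.
Qed.

(** * Orthonormal flags for nil algebras *)

Section NilAlgebras.
Variables (C : numClosedFieldType) (n : nat) (N : {vspace 'M[C]_n.+1}).
Hypothesis algN : operator_algebra N.
Hypothesis nilN : forall X, X \in N -> exists k, X ^+ k = 0.
Implicit Types (X : 'M[C]_n.+1) (V : {vspace 'cV[C]_n.+1}).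

Definition orbit_space (w : 'cV[C]_n.+1) : {vspace 'cV[C]_n.+1} :=
  (linfun (mulmxr w) @: N)%VS.

Lemma mem_orbit_space w X : X \in N -> X *m w \in orbit_space w.
Proof. by move=> XN; have := memv_img (linfun (mulmxr w)) XN; rewrite lfunE. Qed.

Lemma orbit_spaceP w x : x \in orbit_space w -> exists2 X, X \in N & x = X *m w.
Proof. by case/memv_imgP=> X XN ->; exists X; rewrite // lfunE. Qed.

Definition stable V := forall X v, X \in N -> v \in V -> X *m v \in V.

(** Modulo [V], the vector [v] is nonzero and killed by all of [N] at once, as in Engel's theorem.
    The induction is on the dimension of [orbit_space w + V]. *)
Lemma stable_exists_new V w : stable V -> w \notin V ->
  exists2 v, v \notin V & forall X, X \in N -> X *m v \in V.
Proof.
move=> stV; have [d] := ubnP (\dim (orbit_space w + V)).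
elim: d => // d IHd in w *; rewrite ltnS => led wV.
have [NwV|] := boolP (orbit_space w <= V)%VS.
  by exists w => // X XN; apply: subvP NwV _ (mem_orbit_space w XN).
case/subvPn=> w' w'_orb w'V; apply: IHd (w'V); apply: leq_trans led.
have sub : (orbit_space w' + V <= orbit_space w + V)%VS.
  rewrite subv_add addvSr andbT; apply/subvP=> x /orbit_spaceP[X XN ->].
  have [Y YN ->] := orbit_spaceP w'_orb; rewrite mulmxA.
  by apply: subvP (addvSl _ _) _ _; apply/mem_orbit_space/algN.
(* Equal dimensions would make the two sums equal, and then [w'] would lie in
   [orbit_space w' + V]. *)
rewrite ltn_neqAle dimvS // andbT; apply: contraNneq w'V => eqdim.
have : w' \in (orbit_space w' + V)%VS.
  have /eqP -> : (orbit_space w' + V == orbit_space w + V)%VS.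
    by rewrite eqEdim sub eqdim leqnn.
  exact: subvP (addvSl _ _) _ w'_orb.
(* w' = X w' + v iterates to w' = X ^ k w' modulo V, and X is nilpotent. *)
case/memv_addP=> _ /orbit_spaceP[X XN ->] [v vV w'E].
have [k Xk] := nilN XN.
suff : w' - X ^+ k *m w' \in V by rewrite Xk mul0mx subr0.
elim: k {Xk} => [|k IHk]; first by rewrite expr0 mul1mx subrr mem0v.
rewrite {1}w'E exprS -mulmxA addrAC -mulmxBr.
by rewrite memvD // stV.
Qed.

(** The list grows one vector at a time; its span is [N]-stable at every stage, so the previous
    lemma supplies the next direction. *)
Lemma nil_algebra_orthonormal_flag : exists2 e : n.+1.-tuple 'cV[C]_n.+1,
  orthonormal_basis e & forall X, X \in N ->
    forall k, (k < n.+1)%N -> X *m e`_k \in <<take k e>>%VS.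
Proof.
suff flag m : (m <= n.+1)%N -> exists2 s : seq 'cV[C]_n.+1,
    size s = m /\ orthonormal (@cdot C n.+1) s &
    forall X, X \in N -> forall k, (k < m)%N -> X *m s`_k \in <<take k s>>%VS.
  have [s [sz on_s] Ns] := flag n.+1 (leqnn _).
  have sz' : size s == n.+1 by apply/eqP.
  exists (Tuple sz') => //; split=> //.
  rewrite basisEfree subvf sz dimvf /dim /= muln1 leqnn !andbT.
  exact: orthonormal_free on_s.
elim: m => [|m IHm] lemn; first by exists [::].
have [s [sz on_s] Ns] := IHm (ltnW lemn).
have spanP X k : X \in N -> (k < m)%N -> X *m s`_k \in <<s>>%VS.
  move=> XN /(Ns X XN); apply: subvP; apply: sub_span; exact: mem_take.
have stV : stable <<s>>%VS.
  move=> X v XN /(@coord_span _ _ _ (in_tuple s)) ->.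
  rewrite mulmx_sumr memv_suml // => i _; rewrite -scalemxAr memvZ //.
  by apply: spanP; rewrite // -sz.
have [w ws] : exists w, w \notin <<s>>%VS.
  have /subvPn[w _ ws] : ~~ (fullv <= <<s>>)%VS.
    apply/negP=> /dimvS; rewrite dimvf /dim /= muln1; apply/negP; rewrite -ltnNge.
    by rewrite (leq_ltn_trans (dim_span _)) // sz.
  by exists w.
have [v vs Nv] := stable_exists_new stV ws.
(* A Gram-Schmidt step: [y] differs from [v] by a vector of the stable span, so [N] still maps it
   into that span. *)
have [x xs [y [vE _ ys]]] := orthogonal_split (@cdot C n.+1) s v.
have y0 : y != 0 by apply: contraNneq vs => y0; rewrite vE y0 addr0.
pose z := (sqrtC (cdot y y))^-1 *: y.
exists (rcons s z).
  rewrite size_rcons sz -cats1 orthonormal_cat on_s /=; split=> //.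
  rewrite orthogonal_sym; apply/andP; split.
    rewrite /orthonormal /= !andbT dnormZ normfV exprVn.
    by rewrite ger0_norm ?sqrt_dnorm_ge0 // sqrtCK mulVf ?dnorm_eq0.
  apply/orthoPl=> u us; rewrite linearZl_LR.
  by have /orthoPl/(_ u us) yu := ys; rewrite [X in _ * X]yu mulr0.
move=> X XN k; rewrite ltnS leq_eqVlt => /orP[/eqP ->|km].
  rewrite -cats1 nth_cat -sz ltnn subnn take_size_cat //= /z -scalemxAr memvZ //.
  have -> : y = v - x by rewrite vE addrC addKr.
  by rewrite mulmxBr memvB ?Nv ?stV.
by rewrite -cats1 nth_cat sz km takel_cat ?sz 1?ltnW //; apply: Ns.
Qed.

End NilAlgebras.

(** * Triangular matrices in terms of flags *)

Section Bases.
Variables (C : numClosedFieldType) (n : nat) (e : n.+1.-tuple 'cV[C]_n.+1).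
Hypothesis e_basis : basis_of fullv e.
Implicit Types X Z : 'M[C]_n.+1.

(** [Z] sends the span of the first [k.+1] basis vectors into that of the first [k], so [Z ^+ k]
    kills the latter. *)
Lemma strictly_triangular_nilpotent Z :
  (forall j, (j < n.+1)%N -> Z *m e`_j \in <<take j e>>%VS) -> Z ^+ n.+1 = 0.
Proof.
move=> Ze; suff Zk k v : (k <= n.+1)%N -> v \in <<take k e>>%VS -> Z ^+ k *m v = 0.
  apply/matrixP=> i j.
  have /colP/(_ i) : Z ^+ n.+1 *m (delta_mx j 0 : 'cV_n.+1) = 0.
    apply: Zk => //; rewrite -[X in take X _](size_tuple e) take_size.
    by rewrite (span_basis e_basis) memvf.
  by rewrite -colE !mxE.
elim: k v => [|k IHk] v kn; first by rewrite take0 span_nil memv0 => /eqP ->; rewrite mulmx0.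
move=> vk; rewrite exprSr -mulmxA; apply: IHk (ltnW kn) _.
have sub : (<<take k.+1 e>> <= linfun (mulmx Z) @^-1: <<take k e>>)%VS.
  apply/span_subvP=> x /(nthP 0)[j].
  rewrite size_take size_tuple -/(minn _ _) (minn_idPl kn) => jk <-.
  rewrite nth_take // -memv_preim lfunE /=.
  apply: subvP (Ze j (leq_trans jk kn)); apply: sub_span => y.
  by rewrite -(take_takel e (jk : (j <= k)%N)); apply: mem_take.
by have := subvP sub v vk; rewrite -memv_preim lfunE.
Qed.

Lemma triangular_sub_diagonal X j :
    upper_triangular (matrix_in_basis e X) ->
    constant_diagonal (matrix_in_basis e X) -> (j < n.+1)%N ->
  (X - (matrix_in_basis e X 0 0)%:M) *m e`_j \in <<take j e>>%VS.
Proof.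
set M := matrix_in_basis e X => triM diagM jn; pose j' := Ordinal jn.
rewrite mulmxBl mul_scalar_mx (coord_basis e_basis (memvf (X *m e`_j))).
rewrite (bigD1 j') //= (_ : coord e j' _ = M 0 0); last first.
  by rewrite (diagM 0 j') mxE (tnth_nth 0).
rewrite addrAC subrr add0r memv_suml // => i; rewrite -val_eqE /= => neq_ij.
have [ij|ij|ij] := ltngtP i j; last by rewrite ij eqxx in neq_ij.
  rewrite memvZ // memv_span // -(nth_take 0 ij) mem_nth // size_take size_tuple.
  by rewrite jn.
have -> : coord e i (X *m e`_j) = M i j' by rewrite mxE (tnth_nth 0).
by rewrite triM // scale0r mem0v.
Qed.

Lemma coord_take_eq0 (i : 'I_n.+1) j x :
  (j <= i)%N -> x \in <<take j e>>%VS -> coord e i x = 0.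
Proof.
move=> ji xj; have jn : (j < n.+1)%N by apply: leq_ltn_trans (ltn_ord i).
have sub : (<<take j e>> <= lker (linfun (coord e i : _ -> C^o)))%VS.
  apply/span_subvP=> y /(nthP 0)[k]; rewrite size_take size_tuple jn => kj <-.
  rewrite nth_take // memv_ker lfunE /=.
  have kn : (k < n.+1)%N := ltn_trans kj jn.
  rewrite -[k]/(val (Ordinal kn)) coord_free ?(basis_free e_basis) //.
  by rewrite -val_eqE /= (ltn_eqF (leq_trans kj ji)).
by have := subvP sub x xj; rewrite memv_ker lfunE => /eqP.
Qed.

(** On and below the diagonal only the scalar part [a%:M] contributes to the entries. *)
Lemma triangular_of_strict X (a : C) :
    (forall j, (j < n.+1)%N -> (X - a%:M) *m e`_j \in <<take j e>>%VS) ->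
  upper_triangular (matrix_in_basis e X) /\
  constant_diagonal (matrix_in_basis e X).
Proof.
move=> Xe; have XE (i j : 'I_n.+1) : (j <= i)%N ->
    matrix_in_basis e X i j = a * (i == j)%:R.
  move=> ji; rewrite mxE (tnth_nth 0) -[X](subrK a%:M) mulmxDl linearD /=.
  rewrite (coord_take_eq0 ji (Xe j (ltn_ord j))) add0r mul_scalar_mx linearZ /=.
  by rewrite coord_free ?(basis_free e_basis) // eq_sym.
split=> [i j ji|i j]; last by rewrite !XE // !eqxx.
by rewrite XE 1?ltnW // -val_eqE gtn_eqF // mulr0.
Qed.

End Bases.

(** * The individual implications and the equivalence *)

Section Equivalences.
Variables (C : numClosedFieldType) (n : nat) (A : {vspace 'M[C]_n.+1}).
Implicit Types (X P S : 'M[C]_n.+1).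

Lemma constant_triangular_nilpotent e X :
    orthonormal_basis e -> upper_triangular (matrix_in_basis e X) ->
    constant_diagonal (matrix_in_basis e X) ->
  exists a : C, (X - a%:M) ^+ n.+1 = 0.
Proof.
move=> [e_basis _] triX diagX; exists (matrix_in_basis e X 0 0).
by apply: (strictly_triangular_nilpotent e_basis) => j; apply: triangular_sub_diagonal.
Qed.

(** Conjugation fixes scalars and commutes with powers, so [a] and the exponent carry over. *)
Lemma conj_algebra_nilpotent S k : S \in unitmx ->
    (forall X, X \in A -> exists a : C, (X - a%:M) ^+ k = 0) ->
  forall Y, Y \in conj_algebra S A -> exists a : C, (Y - a%:M) ^+ k = 0.
Proof.
move=> Su nilA _ /memv_imgP[X /nilA[a Xa] ->]; exists a; rewrite lfunE /=.
have -> : S *m X *m invmx S - a%:M = S *m (X - a%:M) *m invmx S.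
  by rewrite mulmxBr mulmxBl -[a%:M in RHS]scalemx1 -scalemxAr mulmx1 -scalemxAl
             mulmxV // scalemx1.
have -> m : (S *m (X - a%:M) *m invmx S) ^+ m = S *m (X - a%:M) ^+ m *m invmx S.
  elim: m => [|m IHm]; first by rewrite !expr0 mulmx1 mulmxV.
  by rewrite !exprS IHm -!mulmxE !mulmxA mulmxKV.
by rewrite Xa mulmx0 mul0mx.
Qed.

Lemma similar_antisymmetric_projection P :
    (forall S, S \in unitmx -> antisymmetric_alg (conj_algebra S A)) ->
  P \in A -> P *m P = P -> P = 0 \/ P = 1%:M.
Proof.
move=> asymA PA PP; have [S Su [d dE]] := projection_diagonalizable PP.
have dd : diag_mx d *m diag_mx d = diag_mx d.
  by rewrite -dE !mulmxA mulmxKV // -[S *m P *m P]mulmxA PP.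
(* A diagonal idempotent has entries 0 and 1, which are real, so it is self-adjoint for the standard
   product. *)
have d_real : map_mx conjC d = d.
  apply/rowP=> i; have /matrixP/(_ i i) := dd.
  rewrite mul_diag_mx !mxE eqxx !mulr1n => /eqP.
  rewrite -subr_eq0 -[X in _ - X]mulr1 -mulrBr mulf_eq0 subr_eq0.
  by case/orP=> /eqP ->; rewrite ?conjC0 ?conjC1.
have adj_d := diag_mx_adjoint d; rewrite d_real in adj_d.
have dA : diag_mx d \in conj_algebra S A by rewrite -dE mem_conj_algebra.
have PE : P = invmx S *m diag_mx d *m S by rewrite -dE !mulmxA mulVmx // mul1mx mulmxKV.
case: (antisymmetric_selfadjoint_projection (asymA S Su) dA dd adj_d) => dS.
  by left; rewrite PE dS mulmx0 mul0mx.
by right; rewrite PE dS mulmx1 mulVmx.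
Qed.

Lemma dot_antisymmetric_projection P :
    (forall ip : {dot 'cV[C]_n.+1 for conjC}, antisymmetric_wrt ip A) ->
  P \in A -> P *m P = P -> P = 0 \/ P = 1%:M.
Proof.
move=> asymA PA PP.
exact: antisymmetric_selfadjoint_projection (asymA (proj_dot P)) PA PP
         (proj_dot_adjoint PP).
Qed.

Lemma no_projection_unique_eigenvalue X :
    operator_algebra A ->
    (forall P, P \in A -> P *m P = P -> P = 0 \/ P = 1%:M) ->
  X \in A -> exists! a, is_eigenvalue X a.
Proof.
move=> algA projA XA.
have [|a Xa] := closed_rootP (char_poly X) _; first by rewrite size_char_poly.
exists a; split=> [|b /is_eigenvalueE Xb]; first exact/is_eigenvalueE.
apply/eqP; apply: contraT => neq_ab.
have sep c d : root (char_poly X) c -> root (char_poly X) d -> c != d -> c != 0 -> false.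
  move=> Xc Xd neq_cd c0.
  have [P [PA PP P0 P1]] := algebra_separating_projection algA XA Xc Xd neq_cd c0.
  by case: (projA P PA PP) => PE; [rewrite PE eqxx in P0 | rewrite PE eqxx in P1].
(* The separating idempotent must take the value 1 at a nonzero eigenvalue; of two distinct ones at
   least one qualifies. *)
have [a0|a0] := eqVneq a 0; last exact: (sep a b).
by rewrite eq_sym in neq_ab; apply: (sep b a) => //; rewrite -a0.
Qed.

Lemma unique_eigenvalue_triangular :
    operator_algebra A ->
    (forall X, X \in A -> exists! a, is_eigenvalue X a) ->
  exists2 e : n.+1.-tuple 'cV[C]_n.+1, orthonormal_basis e &
    forall X, X \in A -> upper_triangular (matrix_in_basis e X) /\
                         constant_diagonal (matrix_in_basis e X).
Proof.
move=> algA oneA.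
have [|e e_on Ne] := nil_algebra_orthonormal_flag (traceless_algebra algA oneA).
  by move=> X /(traceless_nilpotent oneA); exists n.+1.
exists e => // X XA; have [a Xa] := sub_scalar_traceless algA oneA XA.
by apply: (triangular_of_strict (proj1 e_on)) => j; apply: Ne Xa j.
Qed.

End Equivalences.

Theorem theorem4p3 (R : realType) (n : nat) (hn : (0 < n)%N)
    (A : {vspace 'M[R[i]]_n}) (hA : operator_algebra A) :
  [<-> exists2 e : n.-tuple 'cV[R[i]]_n, orthonormal_basis e &
         forall X : 'M[R[i]]_n, X \in A ->
           upper_triangular (matrix_in_basis e X) /\
           constant_diagonal (matrix_in_basis e X);
       forall S : 'M[R[i]]_n, S \in unitmx ->
         antisymmetric_alg (conj_algebra S A);
       forall ip : {dot 'cV[R[i]]_n for conjC}, antisymmetric_wrt ip A;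
       forall P : 'M[R[i]]_n, P \in A -> P *m P = P -> P = 0 \/ P = 1%:M;
       forall X : 'M[R[i]]_n, X \in A -> exists! a : R[i], is_eigenvalue X a].
Proof.
(* In dimension 0 no operator has an eigenvalue, so the last condition would fail while the first
   holds. *)
case: n hn A hA => // m _ A algA.
tfae.
- move=> [e e_on triA] S Su; apply: scalar_add_nilpotent_antisymmetric (m.+1) _.
  apply: conj_algebra_nilpotent => // X XA; have [triX diagX] := triA X XA.
  exact: constant_triangular_nilpotent e_on triX diagX.
(* This passage from similarities to inner products runs through the absence of projections and the
   single eigenvalue. *)
- move=> asymA ip; apply: scalar_add_nilpotent_antisymmetric (m.+1) _.
  apply: scalar_add_nilpotent => // X; apply: no_projection_unique_eigenvalue => // P.
  exact: similar_antisymmetric_projection.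
- by move=> asymA P; apply: dot_antisymmetric_projection.
- by move=> projA X; apply: no_projection_unique_eigenvalue.
- exact: unique_eigenvalue_triangular.
Qed.
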